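(* Work over $K=\mathbf{C}$. Let $G$ be a reductive algebraic group, $U\subseteq G$ a unipotent subgroup, $X$ an affine $G$-variety and $Y$ an affine $G$-variety. Let $G/\!\!/U=\mathrm{Spec}\,K[G]^U$ and $\iota\colon X\to G/\!\!/U\times X$ be as in the context. Let $\mu'\colon G/\!\!/U\times X\to Y$ be a $G$-invariant morphism, together with a dominant $U$-invariant morphism of affine varieties $\mu\colon X\to Y$, $x\mapsto(f_1(x),\dots,f_s(x))$, such that $\mu'\circ\iota=\mu$. Assume that (1) $Y$ is normal; (2) $\mu$ separates the $U$-orbits generically, that is, there is an open subset $Y_U\subseteq Y$ such that $\mu(x)\neq\mu(x')$ for all $x,x'\in X_U:=\mu^{-1}(Y_U)$ lying in different $U$-orbits; and (3) $\mathrm{codim}_Y(\overline{Y\setminus Y_U})\ge 2$ or $\mu$ is surjective. Then $\mu$ is an algebraic $U$-quotient of $X$, that is, $Y\cong X/\!\!/U$.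
   Context: The group $U$ acts on $G$ by right multiplication; $K[G]^U$ is a finitely generated $K$-algebra and $G/\!\!/U:=\mathrm{Spec}\,K[G]^U$, with canonical dominant morphism $\pi_{G/\!\!/U}\colon G\to G/\!\!/U$. The group $G$ acts on $G/\!\!/U$ by left multiplication, and there is an element $\overline e\in G/\!\!/U$ with $\pi_{G/\!\!/U}(g)=g\overline e$ for all $g\in G$. $G$ acts diagonally on $G/\!\!/U\times X$, and $\iota\colon X\to G/\!\!/U\times X$ is the natural morphism $x\mapsto(\overline e,x)$. The action of $G$ on $X$ restricts to an action of $U$, and $K[X]^U$ is finitely generated. A $U$-invariant morphism $\pi\colon X\to Y$ to an affine variety $Y$ is called an algebraic $U$-quotient of $X$ if for every $U$-invariant morphism $f\colon X\to Z$ there is a unique morphism $\hat f\colon Y\to Z$ with $f=\hat f\circ\pi$; one then writes $Y=X/\!\!/U$, and $X/\!\!/U=\mathrm{Spec}\,K[X]^U$.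
   Formalization: In (3), the codimension alternative also requires Y_U ⊆ μ(X) (else false: U trivial, {xy=1}→A¹); Y_U is nonempty; varieties are irreducible, and the targets Z in the universal property are affine. *)

(* Defs.v *)
From HB Require Import structures.
From mathcomp Require Import all_boot all_order all_algebra.
From mathcomp Require Export complex.
From mathcomp Require Import mpoly.
From mathcomp Require Import boolp classical_sets reals.

Set Implicit Arguments.
Unset Strict Implicit.
Unset Printing Implicit Defensive.

Import GRing.Theory.
Local Open Scope classical_set_scope.
Local Open Scope ring_scope.

(* Classical affine algebraic geometry over an algebraically closed field K:   *)
(* an affine algebraic set is a Zariski closed subset of K^n, a point of which *)
(* is a row vector v, and p.@[v 0] is the value of the polynomial p at v.      *)

Section Zariski.
Variables (K : fieldType) (n : nat).
Implicit Types V W Z : set 'rV[K]_n.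

Definition vanishes_on (p : {mpoly K[n]}) V := forall v, V v -> p.@[v 0] = 0.

Definition zclosure V : set 'rV[K]_n :=
  [set v | forall p, vanishes_on p V -> p.@[v 0] = 0].

Definition zclosed V := exists I : set {mpoly K[n]},
  V = [set v | forall p, I p -> p.@[v 0] = 0].

Definition zopen_in V W := W `<=` V /\ zclosed (V `\` W).

Definition zirreducible V :=
  V !=set0 /\
  forall A B, zclosed A -> zclosed B -> V `<=` A `|` B -> V `<=` A \/ V `<=` B.

Definition zconnected V :=
  forall A B, zclosed A -> zclosed B -> V `<=` A `|` B ->
    V `&` A `&` B = set0 -> V `<=` A \/ V `<=` B.

(* Varieties are irreducible; for reducible X the claim fails: the bijection   *)
(* from the disjoint union of {xy = 1} and a point onto the affine line.       *)
Definition affine_variety V := zclosed V /\ zirreducible V.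

(* codim_V(Z) >= k, the codimension being the infimum, over the irreducible    *)
(* closed subsets W of Z, of the lengths of the chains of irreducible closed   *)
(* subsets of V that start at W; it is infinite when Z is empty.               *)
Definition codim_ge V Z (k : nat) :=
  forall W, affine_variety W -> W `<=` Z ->
    exists C : nat -> set 'rV[K]_n,
      [/\ C 0%N = W,
          forall i, (i <= k)%N -> affine_variety (C i) /\ C i `<=` V
        & forall i, (i < k)%N -> C i `<` C i.+1].

(* K[V] is integrally closed in K(V). An element of K(V) is a fraction a / b   *)
(* with b not identically zero on V; V being irreducible, two of them are      *)
(* equal when they agree wherever their denominators do not vanish.            *)
Definition normal_variety V :=
  affine_variety V /\
  forall (a b : {mpoly K[n]}) (d : nat) (c : 'I_d -> {mpoly K[n]}),
    ~ vanishes_on b V ->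
    (forall v, V v -> b.@[v 0] != 0 ->
       (a.@[v 0] / b.@[v 0]) ^+ d
       + \sum_(i < d) (c i).@[v 0] * (a.@[v 0] / b.@[v 0]) ^+ i = 0) ->
    exists r : {mpoly K[n]},
      forall v, V v -> b.@[v 0] != 0 -> a.@[v 0] / b.@[v 0] = r.@[v 0].

End Zariski.

(* The source of a regular function is a subset S of a type T which the map    *)
(* crd embeds into an affine space: row vectors with id, matrix groups with    *)
(* gl_coord below, products with the concatenation of coordinates.             *)
Section Regular.
Variables (K : fieldType) (T : Type) (N : nat) (crd : T -> 'rV[K]_N).
Implicit Type S : set T.

Definition regular S (f : T -> K) :=
  exists p : {mpoly K[N]}, forall t, S t -> f t = p.@[crd t 0].

Definition morphism S m (W : set 'rV[K]_m) (f : T -> 'rV[K]_m) :=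
  (forall t, S t -> W (f t)) /\ forall j, regular S (fun t => f t 0 j).

Definition dominant S m (W : set 'rV[K]_m) (f : T -> 'rV[K]_m) :=
  W `<=` zclosure (f @` S).

(* Below, E t t' says that t and t' lie in the same orbit of a group. *)
Definition orbit_invariant (A : Type) (E : T -> T -> Prop) S (f : T -> A) :=
  forall t t', S t -> S t' -> E t t' -> f t = f t'.

(* pi : S -> Q exhibits Q as Spec K[S]^E: its comorphism is an isomorphism     *)
(* from K[Q] onto the algebra of the invariant regular functions on S.         *)
Definition spec_invariants (E : T -> T -> Prop) S m (Q : set 'rV[K]_m)
    (pi : T -> 'rV[K]_m) :=
  [/\ zclosed Q, morphism S Q pi,
      forall p : {mpoly K[m]},
        (forall t, S t -> p.@[pi t 0] = 0) -> vanishes_on p Q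
    & forall f, regular S f ->
        orbit_invariant E S f <->
        exists p : {mpoly K[m]}, forall t, S t -> f t = p.@[pi t 0]].

End Regular.

(* The targets Z are affine: for the universal property to hold for            *)
(* Spec K[X]^U, quasi-affine ones (e.g. SL_2 -> SL_2 / U) have to be excluded. *)
Definition algebraic_quotient (K : fieldType) m s (E : 'rV[K]_m -> 'rV[K]_m -> Prop)
    (X : set 'rV[K]_m) (Y : set 'rV[K]_s) (pi : 'rV[K]_m -> 'rV[K]_s) :=
  [/\ morphism id X Y pi, orbit_invariant E X pi
    & forall k (Z : set 'rV[K]_k) (f : 'rV[K]_m -> 'rV[K]_k),
        zclosed Z -> morphism id X Z f -> orbit_invariant E X f ->
        exists fhat : 'rV[K]_s -> 'rV[K]_k,
          [/\ morphism id Y Z fhat, forall x, X x -> f x = fhat (pi x)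
            & forall h, morphism id Y Z h ->
                (forall x, X x -> f x = h (pi x)) ->
                forall y, Y y -> h y = fhat y]].

(* Linear algebraic groups are the closed subgroups of GL_n, GL_n itself being *)
(* the closed subset of K^(n^2 + 1) of the pairs (A, det(A)^-1).               *)
Section Groups.
Variables (K : fieldType) (n : nat).
Implicit Types G U N : set 'M[K]_n.

Definition gl_coord (A : 'M[K]_n) : 'rV[K]_(n * n + 1) :=
  row_mx (mxvec A) (\det A)^-1%:M.

Definition algebraic_group G :=
  [/\ forall A, G A -> A \in unitmx, zclosed (gl_coord @` G), G 1%:M,
      forall A B, G A -> G B -> G (A *m B) & forall A, G A -> G (invmx A)].

Definition unipotent_group U :=
  algebraic_group U /\ forall A, U A -> exists k, (A - 1%:M) ^+ k = 0.

(* The unipotent radical of G is trivial. *)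
Definition reductive_group G :=
  algebraic_group G /\
  forall N, unipotent_group N -> zconnected (gl_coord @` N) -> N `<=` G ->
    (forall A B, G A -> N B -> N (A *m B *m invmx A)) -> N = [set 1%:M].

Definition algebraic_action G m (X : set 'rV[K]_m)
    (act : 'M[K]_n -> 'rV[K]_m -> 'rV[K]_m) :=
  [/\ morphism (fun gx : 'M[K]_n * 'rV[K]_m => row_mx (gl_coord gx.1) gx.2)
        (G `*` X) X (fun gx => act gx.1 gx.2),
      forall x, X x -> act 1%:M x = x
    & forall g h x, G g -> G h -> X x -> act (g *m h) x = act g (act h x)].

Definition same_orbit U m (act : 'M[K]_n -> 'rV[K]_m -> 'rV[K]_m)
    (x x' : 'rV[K]_m) := exists2 u, U u & x' = act u x.

Definition same_left_coset U (g g' : 'M[K]_n) := exists2 u, U u & g' = g *m u.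

End Groups.

(* mu separates the U-orbits over YU. Generically means that YU is not empty,  *)
(* i.e. dense in the irreducible Y.                                            *)
Definition separates_orbits_generically (K : fieldType) m s
    (E : 'rV[K]_m -> 'rV[K]_m -> Prop) (X : set 'rV[K]_m) (Y YU : set 'rV[K]_s)
    (mu : 'rV[K]_m -> 'rV[K]_s) :=
  [/\ zopen_in Y YU, YU !=set0
    & forall x x', X x -> X x' -> YU (mu x) -> YU (mu x') ->
        ~ E x x' -> mu x <> mu x'].

(* Main.v *)
Require Import Defs.
From HB Require Import structures.
From mathcomp Require Import all_boot all_order all_algebra.
From mathcomp Require Import complex.
From mathcomp Require Import mpoly.
From mathcomp Require Import boolp classical_sets reals.
From mathcomp Require Import zify.

(** Let f be a U-invariant regular function on X. It has to be shown that f is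
    a polynomial in mu; the universal property then follows coordinate by
    coordinate ([quotient_of_spec]).

    First, f is a rational function of mu ([separated_rational]). Over YU each
    fibre of mu lies in one orbit, so that f is constant on them. If f did not
    lie in the field K(Y), a general point of Y would admit two values of f,
    arbitrary ones if f is transcendental over K(Y), and two simple roots of
    its minimal polynomial if f is algebraic, the characteristic being 0. For
    a general point of Y, f takes each of these values at a point of X above it,
    because the points of a domain outside a suitable hypersurface extend to
    a finitely generated extension ([specialization_step],
    [specialize_to_point]). The same extension property contains the
    Nullstellensatz.

    Secondly, the rational function c/b of Y obtained in this way is regular
    ([regular_in_codim1]). Since Y is normal, a rational function that is not
    regular has a pole along a divisor V: there are w vanishing on V and v
    not vanishing identically on V with c/b = v/w ([pole_divisor]). By the
    assumption on the codimension, or trivially if mu is surjective, V contains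
    a point y = mu(x) with v(y) != 0. But w(mu) f = v(mu) on X, and w(y) = 0
    gives v(y) = 0.

    The theorem on poles is proved without dimension theory or valuations. The
    divisor comes from a maximal ideal of denominators of the fraction and its
    multiples ([maximal_denominator]), and both the existence of the pole along
    it and its codimension 1 from the fact that, in a noetherian normal domain,
    a fraction all of whose powers have a common denominator is no proper
    fraction ([almost_integral]). *)

Set Implicit Arguments.
Unset Strict Implicit.
Unset Printing Implicit Defensive.

Import GRing.Theory.
Local Open Scope classical_set_scope.
Local Open Scope ring_scope.

(** * Prime ideals and quotient domains *)

Definition prime_ideal (R : comNzRingType) (P : set R) :=
  [/\ P 0, forall x y, P x -> P y -> P (x + y),
      forall a x, P x -> P (a * x), ~ P 1
    & forall x y, P (x * y) -> P x \/ P y].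

(** Computing in the domain L replaces computing modulo P. The inverses of the
    units of the quotient ring are obtained by choice. *)
Lemma quotient_domain (R : comNzRingType) (P : set R) : prime_ideal P ->
  exists (L : idomainType) (eps : {rmorphism R -> L}),
    (forall x, eps x = 0 <-> P x) /\ forall y, exists x, eps x = y.
Proof.
move=> [P0 PD PM P1 Pprime].
pose S : {pred R} := fun x => `[< P x >].
have SP x : reflect (P x) (x \in S) by exact: asboolP.
have Sid : idealr_closed S.
  split; [exact/SP | exact/SP | move=> a u v /SP Pu /SP Pv].
  by apply/SP/PD => //; apply: PM.
have Spr : prime_idealr_closed S.
  by move=> u v /SP/Pprime[] ?; apply/orP; [left|right]; apply/SP.
pose SJ := HB.pack_for (prime_idealr R) S (isIdealr.Build R S Sid)
  (isPrimeIdealrClosed.Build R S Spr).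
pose L0 : comNzRingType := Quotient.quot SJ.
have L0dom : GRing.integral_domain_axiom L0.
  exact: (@Quotient.rquot_IdomainAxiom R SJ).
pose un : {pred L0} := fun x => `[< exists y, y * x = 1 >].
have unP x : reflect (exists y, y * x = 1) (x \in un) by exact: asboolP.
pose iv (x : L0) := if x \in un then xget 0 [set y | y * x = 1] else x.
have mulVx : {in un, left_inverse 1 iv *%R}.
  move=> x xun; rewrite /iv xun.
  by case: xgetP => [y _ //|H]; case/unP: xun => y /H.
have unPl x y : y * x = 1 -> x \in un by move=> yx; apply/unP; exists y.
have iv_out : {in [predC un], iv =1 id}.
  by move=> x; rewrite inE /iv => /negbTE ->.
pose L1 : comUnitRingType := HB.pack L0
  (GRing.ComNzRing_hasMulInverse.Build L0 mulVx unPl iv_out).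
pose L : idomainType := HB.pack L1
  (GRing.ComUnitRing_isIntegral.Build L1 L0dom).
exists L, (\pi_(Quotient.quot SJ)%qT : {rmorphism R -> L0}); split => [x|y].
  have := Quotient.idealrBE SJ x 0; rewrite subr0 => E.
  have pi0 : (\pi_(Quotient.quot SJ)%qT 0 = 0 :> L0) by exact: rmorph0.
  split => [/= x0|Px]; first by apply/SP; rewrite E pi0; apply/eqP.
  by move/SP: Px; rewrite E pi0 => /eqP.
by exists (repr (y : L0)); exact: reprK.
Qed.

(** * The Hilbert basis theorem *)

Section LinearCombinations.
Variable R : comNzRingType.
Implicit Types (z w : nat -> R) (x y : R).

Definition comb z k x := exists c : nat -> R, x = \sum_(i < k) c i * z i.

Lemma comb0 z k : comb z k 0.
Proof.
by exists (fun _ => 0); rewrite big1 // => i _; rewrite mul0r.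
Qed.

Lemma combD z k x y : comb z k x -> comb z k y -> comb z k (x + y).
Proof.
move=> [c ->] [d ->]; exists (fun i => c i + d i).
by rewrite -big_split; apply: eq_bigr => i _; rewrite mulrDl.
Qed.

Lemma combM z k a x : comb z k x -> comb z k (a * x).
Proof.
move=> [c ->]; exists (fun i => a * c i).
by rewrite big_distrr; apply: eq_bigr => i _; rewrite /= mulrA.
Qed.

Lemma comb_sum z k n (f : 'I_n -> R) :
  (forall i, comb z k (f i)) -> comb z k (\sum_(i < n) f i).
Proof. by move=> H; apply: big_ind => //; [apply: comb0 | apply: combD]. Qed.

Lemma comb_trans z w k n x :
  (forall i, (i < n)%N -> comb w k (z i)) -> comb z n x -> comb w k x.
Proof. by move=> H [c ->]; apply: comb_sum => i; apply/combM/H. Qed.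

Lemma comb_nth z k i : (i < k)%N -> comb z k (z i).
Proof.
move=> ik; exists (fun j => (j == i)%:R).
rewrite (bigD1 (Ordinal ik)) //= eqxx mul1r big1 ?addr0 // => j.
by rewrite -val_eqE /= => /negbTE ->; rewrite mul0r.
Qed.

Lemma comb_mono z k n x : (k <= n)%N -> comb z k x -> comb z n x.
Proof.
by move=> kn; apply: comb_trans => i ik; apply/comb_nth/(leq_trans ik).
Qed.

End LinearCombinations.

(** The ascending chain condition, told on a sequence of generators: the chain
    of the ideals generated by the initial segments of z stops growing. *)
Definition noetherian (R : comNzRingType) :=
  forall z : nat -> R, exists k, comb z k (z k).

Lemma noetherian_field (F : fieldType) : noetherian F.
Proof.
move=> z; have [z0|nz] := eqVneq (z 0%N) 0.
  by exists 0%N; rewrite z0; apply: comb0.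
exists 1%N; rewrite -[X in comb _ _ X](divfK nz).
by apply/combM/comb_nth.
Qed.

Lemma noetherian_image (R S : comNzRingType) (f : {rmorphism R -> S}) :
  (forall y, exists x, f x = y) -> noetherian R -> noetherian S.
Proof.
move=> /choice[g fg] nR z; have [k [c zk]] := nR (g \o z).
exists k, (f \o c); rewrite -(fg (z k)) [g _]zk rmorph_sum.
by apply: eq_bigr => i _; rewrite rmorphM /= fg.
Qed.

(** If no z k is a combination of its predecessors, then the ideal I generated
    by z is not finitely generated, and one can choose g 0, g 1, ... in I, each
    of least degree outside the ideal of the previous ones. The leading
    coefficients of the g k lie in R, so that one of them is a combination of
    its predecessors; the corresponding combination of shifts of the g i cancels
    the leading term of g k and leaves a polynomial of smaller degree outside
    the same ideal. *)
Theorem hilbert_basis (R : comNzRingType) : noetherian R -> noetherian {poly R}.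
Proof.
move=> nR z; apply: contrapT => /forallNP zk.
pose I x := exists k, comb z k x.
pose fresh (l : seq {poly R}) x := I x /\ ~ comb (nth 0 l) (size l) x.
have Isub (l : seq {poly R}) : (forall x, x \in l -> I x) ->
    exists N, forall x, x \in l -> comb z N x.
  elim: l => [|x l IHl] Il; first by exists 0%N.
  have [|N HN] := IHl; first by move=> y yl; apply: Il; rewrite inE yl orbT.
  have [k xk] := Il x (mem_head _ _).
  exists (maxn k N) => y; rewrite inE => /orP[/eqP->|/HN].
    exact: comb_mono (leq_maxl _ _) xk.
  exact: comb_mono (leq_maxr _ _).
have next (l : seq {poly R}) : exists g, (forall x, x \in l -> I x) ->
    fresh l g /\ forall g', fresh l g' -> (size g <= size g')%N.
  have [Il|nIl] := pselect (forall x, x \in l -> I x); last by exists 0 => /nIl.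
  have [N HN] := Isub l Il.
  have fN : fresh l (z N).
    split; first by exists N.+1; apply: comb_nth.
    move=> cN; apply: (zk N); apply: comb_trans cN => i il.
    exact/HN/mem_nth.
  pose S d := `[< exists2 g, fresh l g & size g = d >].
  have exS : exists d, S d by exists (size (z N)); apply/asboolP; exists (z N).
  case: (ex_minnP exS) => d /asboolP[g fg <-] gmin.
  exists g => _; split=> // g' fg'.
  by apply: gmin; apply/asboolP; exists g'.
have [nx Hnx] := choice next => {next}.
pose G k := iter k (fun l => rcons l (nx l)) [::].
pose g k := nx (G k).
have GE k : G k = mkseq g k by elim: k => //= k IH; rewrite mkseqS -IH.
have nthG k i : (i < k)%N -> nth 0 (G k) i = g i.
  by move=> ik; rewrite GE nth_mkseq.
have szG k : size (G k) = k by rewrite GE size_mkseq.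
have fresh_lt k x : fresh (G k) x -> ~ comb g k x.
  move=> [_ nc] c; apply: nc; rewrite szG; apply: comb_trans c => i ik.
  by rewrite -(nthG k) //; apply: comb_nth.
have lt_fresh k x : I x -> ~ comb g k x -> fresh (G k) x.
  move=> Ix nc; split=> //; rewrite szG => c; apply: nc.
  by apply: comb_trans c => i ik; rewrite nthG //; apply: comb_nth.
have gP k : fresh (G k) (g k) /\
    forall g', fresh (G k) g' -> (size (g k) <= size g')%N.
  elim/ltn_ind: k => k IH; apply: Hnx => x; rewrite GE => /mapP[j].
  by rewrite mem_iota => /IH[[Ig _] _] ->.
have Ig k : I (g k) by case: (gP k) => -[].
have nc_g k : ~ comb g k (g k) by apply: fresh_lt; case: (gP k).
have g_neq0 k : g k != 0.
  by apply/eqP => g0; apply: (nc_g k); rewrite g0; apply: comb0.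
have le_size i k : (i <= k)%N -> (size (g i) <= size (g k))%N.
  move=> ik; apply: (gP i).2; apply: lt_fresh => // c.
  by apply: (nc_g k); apply: comb_mono c.
have [k [c lc]] := nR (fun k => lead_coef (g k)).
(* t has the leading term of g k: each g i is shifted to the degree of g k. *)
pose e i := (size (g k) - size (g i))%N.
pose t := \sum_(i < k) ((c i)%:P * 'X^(e i)) * g i.
have ct : comb g k t by apply: comb_sum => i; apply/combM/comb_nth.
have It : I (g k - t).
  have [|N HN] := Isub (G k.+1); first by
    move=> x; rewrite GE => /mapP[j _ ->].
  have gN i : (i < k.+1)%N -> comb z N (g i).
    by move=> ik; apply: HN; rewrite -(nthG k.+1) // mem_nth // szG.
  exists N; apply: combD; first exact: gN.
  rewrite -mulN1r; apply: combM; apply: comb_trans ct => i ik.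
  by apply: gN; apply: ltnW.
have ft : fresh (G k) (g k - t).
  apply: lt_fresh => // cgt; apply: (nc_g k).
  by rewrite -[g k](subrK t); apply: combD.
have := (gP k).2 _ ft; apply/negP; rewrite -ltnNge.
have sg_gt0 i : (0 < size (g i))%N by rewrite size_poly_gt0.
rewrite -(prednK (sg_gt0 k)) ltnS; apply/leq_sizeP => j.
rewrite leq_eqVlt coefB coef_sum => /orP[/eqP<-|ltj].
  rewrite [X in X - _]lc; apply/eqP; rewrite subr_eq0; apply/eqP.
  apply: eq_bigr => i _; rewrite -mulrA coefCM coefXnM.
  have sik := le_size i k (ltnW (ltn_ord i)).
  have -> : ((size (g k)).-1 < e i)%N = false.
    by apply/negbTE; rewrite -leqNgt /e; have := sg_gt0 i; have := sg_gt0 k; lia.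
  rewrite lead_coefE; congr (_ * _`_ _).
  by rewrite /e; have := sg_gt0 i; have := sg_gt0 k; lia.
rewrite prednK // in ltj; rewrite [(g k)`_j]nth_default // sub0r.
apply/eqP; rewrite oppr_eq0; apply/eqP; apply: big1 => i _.
rewrite -mulrA coefCM coefXnM; case: ifP => [|_]; rewrite ?mulr0 //.
have sik := le_size i k (ltnW (ltn_ord i)).
rewrite nth_default ?mulr0 // /e leq_subRL; last exact: leq_trans (leq_subr _ _) ltj.
by rewrite subnK.
Qed.

(** * Specializing one more generator *)

Section Specialization.
Variables (A L : idomainType) (eps : {rmorphism A -> L}).
Implicit Types (p q r s h : {poly A}) (x : L).

Local Notation "p ^eps" := (map_poly eps p) (at level 2, format "p ^eps").

(** The coefficients of p beyond the degree of its image may be nonzero elements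
    of the kernel of eps; this one lifts the leading coefficient of the image. *)
Definition top_coef p := p`_(size p^eps).-1.

Lemma eps_top_coef p : eps (top_coef p) = lead_coef p^eps.
Proof. by rewrite -coef_map. Qed.

Lemma eps_top_coef_neq0 p : p^eps != 0 -> eps (top_coef p) != 0.
Proof. by rewrite eps_top_coef lead_coef_eq0. Qed.

(** Euclidean division in L[T] without leaving the image of A: r may be truncated
    to the degree of its image, and multiplying p by a power of the leading
    coefficient of r avoids the denominators. *)
Lemma pseudo_division p r : r^eps != 0 ->
  exists k q s, (top_coef r ^+ k *: p)^eps = (q * r + s)^eps /\
                (size s^eps < size r^eps)%N.
Proof.
move=> nz_r; pose r' := \poly_(i < size r^eps) r`_i.
have r'eps : r'^eps = r^eps.
  apply/polyP => i; rewrite !coef_map coef_poly; case: ltnP => // ri.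
  by rewrite raddf0 -coef_map nth_default.
have sr_gt0 : (0 < size r^eps)%N by rewrite size_poly_gt0.
have rl_neq0 : top_coef r != 0.
  by apply: contraNneq (eps_top_coef_neq0 nz_r) => ->; rewrite rmorph0.
have sr' : size r' = size r^eps by rewrite size_poly_eq.
have lcr' : lead_coef r' = top_coef r.
  by rewrite lead_coefE sr' coef_poly prednK // leqnn.
exists (scalp p r'), (p %/ r'), (p %% r'); split.
  by rewrite -lcr' Pdiv.Idomain.divp_eq !rmorphD !rmorphM /= r'eps.
rewrite -sr'; apply: leq_ltn_trans (size_poly _ _) _.
by rewrite ltn_modp -size_poly_gt0 sr'.
Qed.

(** A minimal polynomial of x over the fraction field of eps(A), its denominators
    being cleared. *)
Definition minimal_relation p x :=
  [/\ p^eps != 0, p^eps.[x] = 0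
    & forall q, q^eps != 0 -> q^eps.[x] = 0 -> (size p^eps <= size q^eps)%N].

Lemma minimal_relation_exists p x : p^eps != 0 -> p^eps.[x] = 0 ->
  exists q, minimal_relation q x.
Proof.
move=> nz_p px.
pose S d := `[< exists q, [/\ q^eps != 0, q^eps.[x] = 0 & size q^eps = d] >].
have exS : exists d, S d by exists (size p^eps); apply/asboolP; exists p.
case: (ex_minnP exS) => d /asboolP[q [nz_q qx <-]] qmin.
by exists q; split=> // r nz_r rx; apply: qmin; apply/asboolP; exists r.
Qed.

Lemma minimal_relation_size p x : minimal_relation p x -> (1 < size p^eps)%N.
Proof.
move=> [nz_p px _]; rewrite ltnNge; apply/negP => /size1_polyC pC.
by move: nz_p px; rewrite pC hornerC polyC_eq0 => /eqP.
Qed.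

Lemma minimal_relation_dvd p x h : minimal_relation p x -> h^eps.[x] = 0 ->
  exists k q, (top_coef p ^+ k *: h)^eps = (q * p)^eps.
Proof.
move=> [nz_p px pmin] hx; have [k [q [s [E lt_s]]]] := pseudo_division h nz_p.
have sx : s^eps.[x] = 0.
  move/(congr1 (horner^~ x)): E.
  rewrite map_polyZ hornerZ hx mulr0 rmorphD hornerD rmorphM hornerM px.
  by rewrite mulr0 add0r.
exists k, q; rewrite E rmorphD /=.
have [->|nz_s] := eqVneq s^eps 0; first by rewrite addr0.
by have := pmin _ nz_s sx; rewrite leqNgt lt_s.
Qed.

(** If x is algebraic, then every nonzero h(x) divides a nonzero element of
    eps(A), as it would divide its norm. Among the r for which r(x) is a nonzero
    multiple of h(x), take one of least degree. Its degree is smaller than that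
    of p, and the remainder of the division of p by r is a multiple of h(x) at x,
    so that it vanishes there. Hence so does the quotient, which contradicts the
    minimality of p unless r is constant. *)
Lemma minimal_relation_norm p x h : minimal_relation p x -> h^eps.[x] != 0 ->
  exists b q, eps b != 0 /\ (b%:P - q * h)^eps.[x] = 0.
Proof.
move=> [nz_p px pmin] hx.
pose S d := `[< exists r q,
  [/\ (r - q * h)^eps.[x] = 0, r^eps.[x] != 0 & size r^eps = d] >].
have exS : exists d, S d.
  exists (size h^eps); apply/asboolP; exists h, 1.
  by rewrite mul1r subrr rmorph0 horner0.
case: (ex_minnP exS) => d /asboolP[r [q [rq rx <-]]] rmin.
have {}rmin r' q' : (r' - q' * h)^eps.[x] = 0 -> r'^eps.[x] != 0 ->
  (size r^eps <= size r'^eps)%N.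
  by move=> E nz; apply: rmin; apply/asboolP; exists r', q'.
have rqx : r^eps.[x] = q^eps.[x] * h^eps.[x].
  by apply/eqP; rewrite -subr_eq0 -hornerM -rmorphM -hornerN -hornerD -rmorphB rq.
have lt_rp : (size r^eps < size p^eps)%N.
  have [k [u [s [E lt_s]]]] := pseudo_division r nz_p.
  have sx : s^eps.[x] = eps (top_coef p) ^+ k * r^eps.[x].
    move/(congr1 (horner^~ x)): E.
    rewrite rmorphD rmorphM /= map_polyZ hornerZ hornerD hornerM px mulr0 add0r.
    by rewrite rmorphXn.
  apply: leq_ltn_trans lt_s; apply: (rmin _ (top_coef p ^+ k *: q)).
    rewrite rmorphB rmorphM /= map_polyZ !hornerE sx rqx /= rmorphXn mulrA subrr //.
  by rewrite sx mulf_neq0 // expf_neq0 // eps_top_coef_neq0.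
have nz_r : r^eps != 0 by apply: contraNneq rx => ->; rewrite horner0.
have [k [u [s [E lt_s]]]] := pseudo_division p nz_r.
have sx : s^eps.[x] = - (u^eps.[x] * r^eps.[x]).
  apply/eqP; rewrite -addr_eq0 addrC; apply/eqP.
  move/(congr1 (horner^~ x)): E.
  by rewrite rmorphD rmorphM /= map_polyZ hornerZ hornerD hornerM px mulr0.
have sx0 : s^eps.[x] = 0.
  apply/eqP/negP => /negP nz; move: lt_s; rewrite ltnNge; apply/negP/negPn.
  apply: (rmin s (- (u * q))) => //.
  by rewrite mulNr opprK rmorphD !rmorphM /= !hornerE sx rqx mulrA addNr.
have ux : u^eps.[x] = 0.
  by move/eqP: sx; rewrite sx0 eq_sym oppr_eq0 mulf_eq0 (negPf rx) orbF => /eqP.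
have sz1 : (size r^eps <= 1)%N.
  have [u0|nz_u] := eqVneq u^eps 0.
    move/(congr1 (fun v : {poly L} => size v)): E.
    rewrite rmorphD rmorphM /= u0 mul0r add0r map_polyZ size_scale; last first.
      by rewrite rmorphXn expf_neq0 // eps_top_coef_neq0.
    by move=> spE; move: lt_s lt_rp; rewrite spE => /ltn_trans H /H; rewrite ltnn.
  have le_pu := pmin _ nz_u ux.
  have : (size (u^eps * r^eps)%R <= size p^eps)%N.
    have -> : u^eps * r^eps = (top_coef r ^+ k *: p)^eps - s^eps.
      by rewrite E rmorphD rmorphM /= addrK.
    apply: leq_trans (size_polyD _ _) _; rewrite geq_max size_polyN.
    rewrite map_polyZ (leq_trans (size_scale_leq _ _)) //=.
    by apply/ltnW/(ltn_trans lt_s).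
  rewrite size_mul // => le_m; have := leq_trans le_m le_pu.
  have : (0 < size r^eps)%N by rewrite size_poly_gt0.
  case: (size r^eps) => // n _; rewrite addnS /= -{2}[size u^eps]addn0 leq_add2l.
  by case: n.
have rE := size1_polyC sz1.
have rbx : eps r`_0 = r^eps.[x] by rewrite rE hornerC coef_map.
exists r`_0, q; split; first by rewrite rbx.
by rewrite rmorphB rmorphM /= map_polyC /= !hornerE rbx rqx subrr.
Qed.

Lemma minimal_relation_separable p x : [pchar L] =i pred0 ->
  minimal_relation p x -> p^`()^eps.[x] != 0.
Proof.
move=> char0 pm; have [nz_p px pmin] := pm; have sp := minimal_relation_size pm.
have nz_p' : p^`()^eps != 0.
  apply/eqP => /polyP /(_ (size p^eps).-2); rewrite coef0 -deriv_map coef_deriv.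
  have -> : ((size p^eps).-2.+1 = (size p^eps).-1)%N by case: size sp => // -[].
  apply/eqP; rewrite -mulr_natr mulf_neq0 ?lead_coef_eq0 //.
  move/pcharf0P: char0 => ->; rewrite -lt0n; by case: size sp => // -[].
apply/negP => /eqP p'x; have := pmin _ nz_p' p'x.
by rewrite leqNgt -deriv_map lt_size_deriv.
Qed.

Section AtPoint.
Variables (K : idomainType) (phi : {rmorphism A -> K}).
Hypothesis ker_phi : forall c, eps c = 0 -> phi c = 0.

Local Notation "p ^phi" := (map_poly phi p) (at level 2, format "p ^phi").

Lemma specialize_eq p q : p^eps = q^eps -> p^phi = q^phi.
Proof.
move=> pq; apply/polyP => i; rewrite !coef_map.
have pqi : eps p`_i = eps q`_i by move/polyP: pq => /(_ i); rewrite !coef_map.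
have /ker_phi : eps (p`_i - q`_i) = 0 by rewrite rmorphB /= pqi subrr.
by rewrite rmorphB => /eqP; rewrite subr_eq0 => /eqP.
Qed.

Lemma size_specialize p : p^eps != 0 -> phi (top_coef p) != 0 ->
  size p^phi = size p^eps.
Proof.
move=> nz_p nz; apply/eqP; rewrite eqn_leq; apply/andP; split.
  apply/leq_sizeP => j le_j; rewrite coef_map; apply: ker_phi.
  by rewrite -coef_map nth_default.
rewrite -(prednK (n := size p^eps)) ?size_poly_gt0 // ltnNge.
apply: contra nz => /leq_sizeP/(_ _ (leqnn _)).
by rewrite coef_map => ->.
Qed.

(** The morphism phi, as it kills the kernel of eps, is a point of the ring
    eps(A); t is a value that x may take above this point. *)
Definition specializes x t := forall h, h^eps.[x] = 0 -> h^phi.[t] = 0.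

(** Above a point where the leading coefficient of the minimal relation does
    not vanish, any of its roots will do: a power of this coefficient times any
    other relation is a multiple of the minimal one. *)
Lemma specializes_root p x t : minimal_relation p x -> phi (top_coef p) != 0 ->
  p^phi.[t] = 0 -> specializes x t.
Proof.
move=> pm nz pt h hx; have [k [q /specialize_eq]] := minimal_relation_dvd pm hx.
rewrite rmorphM /= map_polyZ => /(congr1 (horner^~ t)).
rewrite hornerZ hornerM pt mulr0 => /eqP; rewrite mulf_eq0 rmorphXn.
by rewrite expf_eq0 (negPf nz) andbF => /eqP.
Qed.

Lemma specialize_norm b q h x t : specializes x t ->
  (b%:P - q * h)^eps.[x] = 0 -> phi b != 0 -> h^phi.[t] != 0.
Proof.
move=> st /st; rewrite rmorphB rmorphM /= map_polyC /= !hornerE => /eqP.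
by rewrite subr_eq0 => /eqP ->; rewrite mulf_eq0 negb_or => /andP[].
Qed.

End AtPoint.
End Specialization.

(** If x is transcendental over eps(A), its value above a point is any nonroot
    of h; otherwise it is a root of the minimal relation p, where the norms of h(x) and of p'(x)
    keep h and p' from vanishing. The second value u shows that, in characteristic
    0, the lift is unique only if x is a fraction of elements of eps(A): an
    algebraic x that is no fraction has p of degree at least 2, with simple roots
    above the chosen points. *)
Lemma specialization_step (K : closedFieldType) (A L : idomainType)
    (eps : {rmorphism A -> L}) (x : L) (h : {poly A}) :
  (map_poly eps h).[x] != 0 ->
  exists2 a, eps a != 0 & forall phi : {rmorphism A -> K},
    (forall c, eps c = 0 -> phi c = 0) -> phi a != 0 ->
    exists t u,
      [/\ specializes eps phi x t /\ (map_poly phi h).[t] != 0,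
          specializes eps phi x u /\ (map_poly phi h).[u] != 0
        & [pchar L] =i pred0 ->
          (forall b c, eps b != 0 -> eps b * x <> eps c) -> t != u].
Proof.
move=> hx.
have [[p0 [nz_p0 p0x]]|trans] :=
    pselect (exists p, map_poly eps p != 0 /\ (map_poly eps p).[x] = 0).
  have [p pm] := minimal_relation_exists nz_p0 p0x.
  have [nz_p px pmin] := pm; have sp := minimal_relation_size pm.
  have [b [q [nz_b bh]]] := minimal_relation_norm pm hx.
  (* In positive characteristic p' may be 0 at x; then b' imposes nothing. *)
  have [b' nz_b' bp'] : exists2 b', eps b' != 0 & [pchar L] =i pred0 ->
      exists q', (map_poly eps (b'%:P - q' * p^`())).[x] = 0.
    have [char0|] := pselect ([pchar L] =i pred0); last first.
      by exists 1; rewrite ?rmorph1 ?oner_neq0.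
    have [b' [q' [nz_b' bp']]] :=
      minimal_relation_norm pm (minimal_relation_separable char0 pm).
    by exists b' => // _; exists q'.
  exists (top_coef eps p * b * b').
    by rewrite !rmorphM !mulf_neq0 ?eps_top_coef_neq0.
  move=> phi ker_phi; rewrite !rmorphM !mulf_eq0 !negb_or -andbA.
  case/and3P => nz_l nz_pb nz_pb'.
  have spp := size_specialize ker_phi nz_p nz_l.
  have root_ok v : (map_poly phi p).[v] = 0 ->
    specializes eps phi x v /\ (map_poly phi h).[v] != 0.
    move=> pv; have sv := specializes_root ker_phi pm nz_l pv.
    by split=> //; apply: specialize_norm bh nz_pb.
  have [|t pt] := closed_rootP (map_poly phi p) _.
    by rewrite spp neq_ltn sp orbT.
  have [r pr] := factor_theorem _ _ pt.
  have p_neq0 : map_poly phi p != 0 by rewrite -size_poly_gt0 spp ltnW.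
  have r_neq0 : r != 0 by apply: contraNneq p_neq0; rewrite pr => ->; rewrite mul0r.
  have sr : size (map_poly phi p) = (size r).+1.
    by rewrite pr size_Mmonic ?monicXsubC // size_XsubC addn2.
  (* If p has degree 1, then x = - p_0 / p_1 is a fraction. *)
  have [sr1|sr1] := eqVneq (size r) 1%N.
    exists t, t; split; [exact/root_ok/rootP|exact/root_ok/rootP|].
    move=> _ /(_ p`_1 (- p`_0)) []; last first.
      move: px; rewrite horner_coef -spp sr sr1 big_ord_recl big_ord1 !coef_map.
      rewrite expr0 expr1 mulr1 /= rmorphN => /eqP.
      by rewrite addrC addr_eq0 => /eqP.
    by have := eps_top_coef_neq0 nz_p; rewrite /top_coef -spp sr sr1.
  have [u ru] := closed_rootP r sr1.
  have pu : (map_poly phi p).[u] = 0.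
    by rewrite pr hornerM (rootP ru) mul0r.
  exists t, u; split; [exact/root_ok/rootP|exact/root_ok|].
  case/bp' => q' {}bp' _.
  have [st _] := root_ok t (rootP pt).
  have := specialize_norm st bp' nz_pb'.
  apply: contra_neq => tu; rewrite -deriv_map pr derivM derivXsubC mulr1.
  by rewrite hornerD hornerM hornerXsubC subrr mulr0 add0r tu (rootP ru).
have nz_h : map_poly eps h != 0 by apply: contraNneq hx => ->; rewrite horner0.
exists (top_coef eps h); first exact: eps_top_coef_neq0.
move=> phi ker_phi nz_l.
have h_neq0 : map_poly phi h != 0.
  apply: contraNneq nz_l => /polyP/(_ (size (map_poly eps h)).-1).
  by rewrite coef0 coef_map => ->.
have sv v : specializes eps phi x v.
  move=> g gx; have [g0|nz_g] := eqVneq (map_poly eps g) 0.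
    rewrite (specialize_eq ker_phi (q := 0)) ?rmorph0 ?horner0 //.
  by case: trans; exists g.
have [t ht] := closed_nonrootP _ h_neq0.
have [|u hu] := closed_nonrootP (map_poly phi h * ('X - t%:P)) _.
  by rewrite mulf_neq0 // polyXsubC_eq0.
move: hu; rewrite rootM root_XsubC negb_or => /andP[hu ut].
by exists t, u; split; rewrite // eq_sym.
Qed.

(** * Finitely generated extensions and the Nullstellensatz *)

(** Iterates [specialization_step]. B is the polynomial ring over A in one variable
    for each entry of xs, and dlt substitutes xs for the variables; a point of
    dlt(B) is a point of eps(A) with a compatible value for each entry. *)
Lemma specialization_tower (K : closedFieldType) (L : idomainType) (xs : seq L)
    (A : idomainType) (eps : {rmorphism A -> L}) :
  exists (B : idomainType) (iota : {rmorphism A -> B}) (dlt : {rmorphism B -> L}),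
  [/\ forall a, dlt (iota a) = eps a,
      forall x, x \in xs -> exists y, dlt y = x
    & forall h, dlt h != 0 -> exists2 a, eps a != 0 &
      forall phi : {rmorphism A -> K},
        (forall c, eps c = 0 -> phi c = 0) -> phi a != 0 ->
        exists psi : {rmorphism B -> K},
          [/\ forall c, psi (iota c) = phi c, forall c, dlt c = 0 -> psi c = 0
            & psi h != 0]].
Proof.
elim: xs A eps => [|x xs IH] A eps.
  exists A, idfun, eps; split=> // h nz_h; exists h => // phi ker_phi nz.
  by exists phi.
have cx : commr_rmorph eps x by move=> c; apply: mulrC.
have [B [iota [dlt [dltE dlt_xs ext]]]] :=
  IH _ (horner_morph cx : {rmorphism {poly A} -> L}).
exists B, (iota \o polyC), dlt; split=> [a|y|h nz_h].
- by rewrite /= dltE /= horner_morphC.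
- rewrite inE => /orP[/eqP->|/dlt_xs //].
  by exists (iota 'X); rewrite dltE /= horner_morphX.
have [a1 nz_a1 ext1] := ext h nz_h.
have [a nz_a ext0] := specialization_step K nz_a1.
exists a => // phi ker_phi /(ext0 _ ker_phi)[t [_ [[st ht] _ _]]].
have ct : commr_rmorph phi t by move=> c; apply: mulrC.
have [psi [psiE ker_psi nz_psi]] :=
  ext1 (horner_morph ct : {rmorphism {poly A} -> K}) st ht.
by exists psi; split=> // c; rewrite /= psiE /= horner_morphC.
Qed.

Lemma mpoly_ring_ind n (R : comNzRingType) (P : {mpoly R[n]} -> Prop) :
  (forall c, P c%:MP) -> (forall i, P 'X_i) ->
  (forall p q, P p -> P q -> P (p + q)) ->
  (forall p q, P p -> P q -> P (p * q)) -> forall p, P p.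
Proof.
move=> PC PX PD PM; elim/mpolyind => [|c m p _ _ Pp]; first exact: (PC 0).
apply: PD => //; rewrite -mul_mpolyC; apply: (PM _ _) => //.
rewrite mpolyXE_id; apply: (big_ind P) => [|p1 p2|i _].
- exact: (PC 1).
- exact: (PM p1 p2).
- elim: (m i) => [|k IH]; first by rewrite expr0; apply: (PC 1).
  by rewrite exprS; apply: PM.
Qed.

Lemma mpoly_morph_eq n (R S : comNzRingType) (f g : {rmorphism {mpoly R[n]} -> S}) :
  (forall c, f c%:MP = g c%:MP) -> (forall i, f 'X_i = g 'X_i) -> f =1 g.
Proof.
move=> fgC fgX; elim/mpoly_ring_ind => // p q fgp fgq.
  by rewrite !rmorphD fgp fgq.
by rewrite !rmorphM fgp fgq.
Qed.

Lemma noetherian_mpoly (F : fieldType) n : noetherian {mpoly F[n]}.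
Proof.
elim: n => [|n IH].
  apply: (noetherian_image (f := @mpolyC 0 F)); last exact: noetherian_field.
  by move=> p; exists p@_0%MM; rewrite [RHS]nvar0_mpolyC.
have cX : commr_rmorph (@mwiden n F) 'X_ord_max by move=> c; apply: mulrC.
apply: (noetherian_image (f := horner_morph cX)); last exact: hilbert_basis.
elim/mpoly_ring_ind => [c|i|p q [p' <-] [q' <-]|p q [p' <-] [q' <-]].
- by exists c%:MP%:P; rewrite /= horner_morphC /= mwidenC.
- have [<-|/unlift_some[j ji _]] := eqVneq ord_max i.
    by exists 'X; rewrite /= horner_morphX.
  exists ('X_(j))%:P; rewrite /= horner_morphC /= mwidenX mnmwiden1.
  congr 'X_[U_(_)]; apply/val_inj.
  by rewrite ji /= /bump leqNgt ltn_ord.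
- by exists (p' + q'); rewrite rmorphD.
- by exists (p' * q'); rewrite rmorphM.
Qed.

(** The geometric form of the lifting: L plays the part of K[X], for X in K^m
    with ideal ker rho, and eps that of the morphism from X to the variety of
    eps(A). It says that the image of the open subset h != 0 of X contains
    a nonempty open subset a != 0. The last clause identifies the given point
    with the image of v. *)
Lemma specialize_to_point (K : closedFieldType) m (L A : idomainType)
    (rho : {rmorphism {mpoly K[m]} -> L}) (eps : {rmorphism A -> L})
    (kappa : {rmorphism K -> A}) (h : {mpoly K[m]}) :
  (forall c, eps (kappa c) = rho c%:MP) -> rho h != 0 ->
  exists2 a, eps a != 0 & forall phi : {rmorphism A -> K},
    (forall c, eps c = 0 -> phi c = 0) -> (forall c, phi (kappa c) = c) ->
    phi a != 0 ->
    exists v : 'rV[K]_m,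
      [/\ forall p, rho p = 0 -> p.@[v 0] = 0, h.@[v 0] != 0
        & forall b p, eps b = rho p -> phi b = p.@[v 0]].
Proof.
move=> epsk nz_h.
have [B [iota [dlt [dltE dltX ext]]]] :=
  specialization_tower K [seq rho 'X_i | i <- enum 'I_m] eps.
have /choice[y yP] (i : 'I_m) : exists z, dlt z = rho 'X_i.
  by apply: dltX; apply/mapP; exists i; rewrite ?mem_enum.
pose tau : {rmorphism {mpoly K[m]} -> B} := mmap (iota \o kappa) y.
have dlt_tau p : dlt (tau p) = rho p.
  apply: (mpoly_morph_eq (f := dlt \o tau)) => [c|i] /=.
    by rewrite mmapC /= dltE.
  by rewrite mmapX mmap1U.
have [|a nz_a ext_a] := ext (tau h); first by rewrite dlt_tau.
exists a => // phi ker_phi phik /(ext_a _ ker_phi)[psi [psiE ker_psi nz]].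
pose v : 'rV[K]_m := \row_i psi (y i).
have psi_tau p : psi (tau p) = p.@[v 0].
  apply: (mpoly_morph_eq (f := psi \o tau) (g := meval (v 0))) => [c|i] /=.
    by rewrite mmapC mevalC /= psiE.
  by rewrite mmapX mmap1U mevalXU mxE.
exists v; split=> [p p0||b p bp]; rewrite -psi_tau //.
  by rewrite ker_psi // dlt_tau.
rewrite -psiE; apply/eqP; rewrite -subr_eq0 -rmorphB; apply/eqP/ker_psi.
by rewrite rmorphB dltE dlt_tau bp subrr.
Qed.

(** The lifting of a point for A = K, a field: the single point of eps(K) lifts
    to a point of the variety of P where h does not vanish. *)
Theorem nullstellensatz (K : closedFieldType) n (P : set {mpoly K[n]}) h :
  prime_ideal P -> ~ P h ->
  exists v : 'rV[K]_n, (forall p, P p -> p.@[v 0] = 0) /\ h.@[v 0] != 0.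
Proof.
move=> /quotient_domain[L [rho [rhoP _]]] nPh.
have nz_h : rho h != 0 by apply/eqP => /rhoP.
pose eps : {rmorphism K -> L} := rho \o @mpolyC n K.
have [//|a nz_a ext] := specialize_to_point (kappa := idfun) (eps := eps) _ nz_h.
have [c /eqP|//||v [vP hv _]] := ext idfun.
- by rewrite fmorph_eq0 => /eqP.
- by apply: contraNneq nz_a => /= ->; rewrite rmorph0.
by exists v; split=> // p /rhoP/vP.
Qed.

(** * Poles in integrally closed noetherian domains *)

Section Poles.
Variable L : idomainType.
Hypothesis noethL : noetherian L.
Hypothesis normL : forall (a b : L) d (c : 'I_d -> L), b != 0 ->
  a ^+ d + \sum_(i < d) c i * a ^+ i * b ^+ (d - i) = 0 ->
  exists r, a = r * b.

(** The hypothesis says that z 0 times any power of a/b lies in L. The z k are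
    these products, and a linear dependence among them, which exists since L is
    noetherian, is an equation of integral dependence for a/b. *)
Lemma almost_integral (a b : L) (z : nat -> L) :
  b != 0 -> z 0%N != 0 -> (forall k, z k * a = b * z k.+1) ->
  exists r, a = r * b.
Proof.
move=> nz_b nz_z0 za.
have zE k : b ^+ k * z k = a ^+ k * z 0%N.
  elim: k => [|k IH]; first by rewrite !expr0.
  by rewrite exprSr -mulrA -za mulrA IH exprSr mulrAC.
have [k [c zk]] := noethL z.
apply: (normL (d := k) (c := fun i => - c i) nz_b).
apply: (mulIf nz_z0); rewrite mul0r mulrDl -zE zk mulr_sumr mulr_suml -big_split.
apply: big1 => i _ /=.
rewrite -[in b ^+ k](subnK (ltnW (ltn_ord i))) exprD !mulNr.
apply/eqP; rewrite subr_eq0; apply/eqP.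
rewrite mulrCA -!mulrA; congr (_ * _); by rewrite zE mulrCA.
Qed.

(** The ideal of denominators of a fraction e c / b is the set of the z with
    e z c in b L. It grows when e is replaced by a multiple, and it stops growing
    at some e for which the fraction is still nonintegral. A growing sequence e k
    of multiples would come with elements y k, each a denominator from the
    stage k+1 on but not at the stage k, contradicting the chain condition. *)
Lemma maximal_denominator (b c : L) : ~ (exists r, c = r * b) ->
  exists2 e, ~ (exists r, e * c = r * b) &
    forall x y, ~ (exists r, e * x * c = r * b) ->
      (exists r, e * x * y * c = r * b) -> exists r, e * y * c = r * b.
Proof.
move=> nbc; apply: contrapT => nomax.
have /choice[f fP] (e : L) : exists xy : L * L, ~ (exists r, e * c = r * b) ->
    [/\ ~ (exists r, e * xy.1 * c = r * b),
        exists r, e * xy.1 * xy.2 * c = r * b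
      & ~ exists r, e * xy.2 * c = r * b].
  apply: contrapT => /forallNP H; apply: nomax; exists e.
    by move=> Be; apply: (H (0, 0)) => /(_ Be).
  move=> x y H1 H2; apply: contrapT => H3.
  by apply: (H (x, y)) => _.
pose e k := iter k (fun e => e * (f e).1) 1.
pose y k := (f (e k)).2.
have bad k : ~ exists r, e k * c = r * b.
  by elim: k => [|k IH]; [rewrite mul1r | case: (fP (e k) IH)].
have ey k : exists r, e k.+1 * y k * c = r * b by case: (fP _ (bad k)).
have eyi k i : (i < k)%N -> exists r, e k * y i * c = r * b.
  elim: k => // k IH; rewrite ltnS leq_eqVlt => /orP[/eqP-> //|/IH[r rE]].
  exists ((f (e k)).1 * r); rewrite -[RHS]mulrA -rE /=.
  by rewrite !mulrA; congr (_ * _ * _); rewrite mulrC.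
have [k [d yk]] := noethL y.
have [_ _] := fP _ (bad k); apply.
have /choice[r rE] (i : 'I_k) : exists r, e k * y i * c = r * b.
  exact: eyi.
exists (\sum_(i < k) d i * r i); rewrite -/(y k) yk mulr_sumr !mulr_suml.
apply: eq_bigr => i _; rewrite -[d i * r i * b]mulrA -rE !mulrA.
by congr (_ * _ * _); rewrite mulrC.
Qed.

(** P is maximal among the ideals of denominators of nonintegral multiples ec/b
    of c/b, hence prime. If multiplication by ec/b mapped P to itself, then all
    b (ec/b)^k would lie in L, and ec/b would be integral by [almost_integral].
    So t (ec/b) = u for some t in P and u outside P, that is c/b = u/(te): the
    fraction has a pole along P. Moreover t generates P locally. A nonzero prime
    Q inside P that misses t is therefore mapped to itself by division by t,
    that is by multiplication by ec/b, and integrality follows again; one that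
    contains t contains P. So P has height one. *)
Theorem pole_divisor (b c : L) : b != 0 -> ~ (exists r, c = r * b) ->
  exists (P : set L) w v,
    [/\ prime_ideal P, P w, ~ P v, w * c = b * v
      & forall Q, prime_ideal Q -> Q `<=` P -> (exists2 y, Q y & y != 0) ->
          P `<=` Q].
Proof.
move=> nz_b /maximal_denominator[e bad emax].
pose P : set L := [set z | exists r, e * z * c = r * b].
have Pprime : prime_ideal P.
  split; rewrite /P /=.
  - by exists 0; rewrite mulr0 !mul0r.
  - move=> x y [r rE] [s sE]; exists (r + s).
    by rewrite mulrDr !mulrDl rE sE.
  - by move=> a x [r rE]; exists (a * r); rewrite [e * _]mulrCA -[LHS]mulrA rE mulrA.
  - by rewrite mulr1.
  - move=> x y exy; have [?|nx] := pselect (exists r, e * x * c = r * b).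
      by left.
    by right; apply: (emax x) => //; rewrite -[e * x * y]mulrA.
have Pb : P b by exists (e * c); rewrite mulrAC.
have Pq z : P z -> exists u, z * (e * c) = b * u.
  by move=> [r rE]; exists r; rewrite [RHS]mulrC -rE mulrA [z * e]mulrC.
have [t [u [Pt nPu tu]]] : exists t u, [/\ P t, ~ P u & t * (e * c) = b * u].
  apply: contrapT => H; apply: bad.
  have /choice[q qP] (z : L) : exists u, P z -> z * (e * c) = b * u.
    have [/Pq[v vE]|nPz] := pselect (P z); first by exists v.
    by exists 0.
  pose z k := iter k q b.
  have Pz k : P (z k).
    elim: k => //= k IH; apply: contrapT => nPq.
    by apply: H; exists (z k), (q (z k)); split=> //; apply: qP.
  by apply: (almost_integral nz_b (z := z)) => // k; apply: qP.
exists P, (t * e), u; split=> //.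
- by case: Pprime => _ _ PM _ _; rewrite mulrC; apply: PM.
- by rewrite -mulrA.
move=> Q [Q0 QD QM Q1 Qprime] QP [y Qy nz_y].
have cross z v : z * (e * c) = b * v -> z * u = v * t.
  move=> zv; apply: (mulfI nz_b).
  by rewrite mulrCA -tu mulrCA zv mulrCA [t * v]mulrC.
have [Qt|nQt] := pselect (Q t).
  move=> z /Pq[v /cross zu].
  have : Q (z * u) by rewrite zu; apply: QM.
  by case/Qprime => // /QP.
have /choice[q qP] (z : L) : exists v, Q z -> z * (e * c) = b * v.
  have [/QP/Pq[v vE]|nQz] := pselect (Q z); first by exists v.
  by exists 0.
pose z k := iter k q y.
have Qz k : Q (z k).
  elim: k => //= k IH.
  have /Qprime[//|//] : Q (q (z k) * t).
  by rewrite -(cross _ _ (qP _ IH)) mulrC; apply: QM.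
case: bad; apply: (almost_integral nz_b (z := z)) => // k; apply: qP.
exact: Qz.
Qed.

End Poles.

(** * Varieties and their ideals *)

Lemma prime_ideal_preimage (R S : comNzRingType) (f : {rmorphism R -> S})
    (P : set S) : prime_ideal P -> prime_ideal (f @^-1` P).
Proof.
move=> [P0 PD PM P1 Pprime]; split; rewrite /preimage /=.
- by rewrite rmorph0.
- by move=> x y Px Py; rewrite rmorphD; apply: PD.
- by move=> a x Px; rewrite rmorphM; apply: PM.
- by rewrite rmorph1.
- by move=> x y; rewrite rmorphM => /Pprime.
Qed.

Lemma prime_ideal_image (R S : comNzRingType) (f : {rmorphism R -> S})
    (P : set R) : (forall y, exists x, f x = y) ->
  (forall x, f x = 0 -> P x) -> prime_ideal P ->
  prime_ideal (f @` P) /\ (forall x, (f @` P) (f x) -> P x).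
Proof.
move=> f_surj ker_f [P0 PD PM P1 Pprime].
have Pf x : (f @` P) (f x) -> P x.
  case=> y Py fyx; rewrite -(subrK y x) addrC; apply: (PD _ _) => //.
  by apply: ker_f; rewrite rmorphB fyx subrr.
split=> //; split.
- by exists 0; rewrite ?rmorph0.
- move=> _ _ [x Px <-] [y Py <-]; exists (x + y); rewrite ?rmorphD //.
  exact: (PD _ _).
- move=> a _ [x Px <-]; have [a' <-] := f_surj a.
  by exists (a' * x); rewrite ?rmorphM //; apply: (PM _ _).
- by rewrite -(rmorph1 f) => /Pf.
- move=> x y; have [x' <-] := f_surj x; have [y' <-] := f_surj y.
  by rewrite -rmorphM => /Pf/Pprime[?|?]; [left; exists x' | right; exists y'].
Qed.

Section Varieties.
Variables (K : fieldType) (n : nat).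
Implicit Types (V : set 'rV[K]_n) (P : set {mpoly K[n]}).

Definition zeros P : set 'rV[K]_n := [set v | forall p, P p -> p.@[v 0] = 0].

Lemma zclosed_zeros P : zclosed (zeros P).
Proof. by exists P. Qed.

Lemma zclosed_mem V (v : 'rV[K]_n) : zclosed V ->
  (forall p, vanishes_on p V -> p.@[v 0] = 0) -> V v.
Proof. by move=> [I ->] H p Ip; apply: H => w; apply. Qed.

Lemma zclosed_separate V (v : 'rV[K]_n) : zclosed V -> ~ V v ->
  exists2 p, vanishes_on p V & p.@[v 0] != 0.
Proof.
move=> clV nVv; apply: contrapT => H; apply: nVv; apply: (zclosed_mem clV) => p pV.
by apply: contrapT => /eqP nz; apply: H; exists p.
Qed.

Lemma vanishing_prime V : zirreducible V ->
  prime_ideal [set p | vanishes_on p V].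
Proof.
move=> [[v0 Vv0] irr]; split; rewrite /vanishes_on /=.
- by move=> v _; rewrite rmorph0.
- by move=> p q pV qV v Vv; rewrite rmorphD /= pV // qV // addr0.
- by move=> a p pV v Vv; rewrite rmorphM /= pV // mulr0.
- by move=> /(_ _ Vv0); rewrite rmorph1 => /eqP; rewrite oner_eq0.
move=> p q pqV.
have [|H|H] := irr _ _ (zclosed_zeros [set p]) (zclosed_zeros [set q]).
- move=> v /pqV; rewrite rmorphM /= => /eqP; rewrite mulf_eq0.
  by case/orP => /eqP ?; [left|right] => _ ->.
- by left=> v /H; apply.
- by right=> v /H; apply.
Qed.

Lemma coordinate_ring V : zirreducible V ->
  exists (L : idomainType) (rho : {rmorphism {mpoly K[n]} -> L}),
    (forall p, rho p = 0 <-> vanishes_on p V) /\ forall y, exists p, rho p = y.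
Proof. by move=> /vanishing_prime/quotient_domain. Qed.

End Varieties.

Lemma vanishing_zeros (K : closedFieldType) n (P : set {mpoly K[n]}) p :
  prime_ideal P -> vanishes_on p (zeros P) -> P p.
Proof.
move=> Pprime pP; apply: contrapT => /(nullstellensatz Pprime)[v [Pv]].
by rewrite pP // eqxx.
Qed.

Lemma zeros_variety (K : closedFieldType) n (P : set {mpoly K[n]}) :
  prime_ideal P -> affine_variety (zeros P).
Proof.
move=> Pprime; have [_ _ PM P1 Pmul] := Pprime.
split; first exact: zclosed_zeros.
split; first by have [v [Pv _]] := nullstellensatz Pprime P1; exists v.
move=> A B clA clB PAB; apply: contrapT => /not_orP[].
move=> /existsNP[v /not_implyP[Pv /(zclosed_separate clA)[p pA pv]]].
move=> /existsNP[w /not_implyP[Pw /(zclosed_separate clB)[q qB qw]]].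
have /Pmul[] : P (p * q).
- apply: vanishing_zeros => // u /PAB[/pA|/qB] u0.
  + by rewrite rmorphM /= u0 mul0r.
  + by rewrite rmorphM /= u0 mulr0.
- by move/Pv/eqP; rewrite (negPf pv).
- by move/Pw/eqP; rewrite (negPf qw).
Qed.

(** Let mu be the morphism with components lq. If f were not a rational function
    of mu, then f would take two values above a general point y0 of the closure
    of mu(X) (the two specializations t and u of f), and both would come from
    points of X, since general points of the closure of (mu, f)(X) are
    values. So f would not be constant on the fibre of y0, although y0 can be
    chosen with g(y0) != 0. *)
Theorem separated_rational (K : closedFieldType) m s (X : set 'rV[K]_m)
    (lq : s.-tuple {mpoly K[m]}) (f : {mpoly K[m]}) (g : {mpoly K[s]}) :
  [pchar K] =i pred0 -> affine_variety X -> ~ vanishes_on (g \mPo lq) X ->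
  (forall x x', X x -> X x' -> (g \mPo lq).@[x 0] != 0 ->
    (forall i, (tnth lq i).@[x 0] = (tnth lq i).@[x' 0]) ->
    f.@[x 0] = f.@[x' 0]) ->
  exists b c, ~ vanishes_on (b \mPo lq) X /\
    vanishes_on ((b \mPo lq) * f - (c \mPo lq)) X.
Proof.
move=> charK [clX irrX] nz_g sep.
have [L [rho [rhoP _]]] := coordinate_ring irrX.
pose A : idomainType := {mpoly K[s]}.
pose eps : {rmorphism A -> L} := rho \o comp_mpoly lq.
have charL : [pchar L] =i pred0.
  by move=> p; rewrite (fmorph_pchar (rho \o @mpolyC m K)) charK.
apply: contrapT => norat.
have notin b c : eps b != 0 -> eps b * rho f <> eps c.
  move=> nz_b bc; apply: norat; exists b, c.
  split; first by move/rhoP/eqP; rewrite (negPf nz_b).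
  by apply/rhoP; rewrite rmorphB rmorphM /= [X in X - _]bc subrr.
have cf : commr_rmorph eps (rho f) by move=> c; apply: mulrC.
pose eps1 : {rmorphism {poly A} -> L} := horner_morph cf.
pose kap1 : {rmorphism K -> {poly A}} := polyC \o @mpolyC s K.
have [c||a1 nz_a1 lift] :=
    @specialize_to_point K m L _ rho eps1 kap1 1 _ _.
- by rewrite /= horner_morphC /= comp_mpolyC.
- by rewrite rmorph1 oner_neq0.
have [a nz_a fork] := specialization_step K nz_a1.
have [x0 Xx0 nz0] : exists2 x, X x & ((a * g) \mPo lq).@[x 0] != 0.
  apply: contrapT => H.
  have /rhoP : vanishes_on ((a * g) \mPo lq) X.
    by move=> x Xx; apply: contrapT => /eqP nz; apply: H; exists x.
  rewrite rmorphM rmorphM => /eqP; rewrite mulf_eq0 (negPf nz_a) /=.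
  by move=> /eqP/rhoP.
pose y0 i := (tnth lq i).@[x0 0].
pose phi : {rmorphism A -> K} := meval y0.
have phiE p : phi p = (p \mPo lq).@[x0 0] by rewrite comp_mpoly_meval.
have ker_phi c : eps c = 0 -> phi c = 0 by move=> /rhoP H; rewrite phiE H.
move: nz0; rewrite !rmorphM mulf_eq0 negb_or /= -!phiE => /andP[nz_pa nz_pg].
have [t [u [[st ht] [su hu] /(_ charL notin) tu]]] := fork phi ker_phi nz_pa.
have point w : specializes eps phi (rho f) w -> (map_poly phi a1).[w] != 0 ->
    exists x, [/\ X x, forall i, (tnth lq i).@[x 0] = y0 i & f.@[x 0] = w].
  move=> sw hw; have cw : commr_rmorph phi w by move=> c; apply: mulrC.
  have [|c||x [xX _ xE]] := lift (horner_morph cw).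
  - exact: sw.
  - by rewrite /= horner_morphC /= mevalC.
  - exact: hw.
  exists x; split=> [|i|].
  - by apply: (zclosed_mem clX) => p /rhoP/xX.
  - rewrite -(xE ('X_i)%:P) /= ?horner_morphC /= ?mevalXU //.
    by rewrite comp_mpolyXU (tnth_nth 0).
  - by rewrite -(xE 'X) /= horner_morphX.
have [x [Xx xE fx]] := point t st ht; have [x' [Xx' xE' fx']] := point u su hu.
move/eqP: tu; apply; rewrite -fx -fx'; apply: sep => // [|i].
  rewrite comp_mpoly_meval (meval_eq (v2 := y0)) //.
by rewrite xE xE'.
Qed.

(** If c/b is not regular, let V be the zero set of the prime P of [pole_divisor].
    If V meets D, it does so at a point where v does not vanish, since v does
    not vanish identically on the irreducible V; there w = 0 and wc = bv are
    incompatible with the absence of poles in D. If V lies in the complement of D, a chain of irreducible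
    closed subsets V, C 1, C 2 of Y gives a nonzero prime, the ideal of C 1,
    strictly inside the ideal of V, which has height one. *)
Theorem regular_in_codim1 (K : closedFieldType) n (Y D : set 'rV[K]_n)
    (b c : {mpoly K[n]}) :
  normal_variety Y -> zopen_in Y D -> codim_ge Y (zclosure (Y `\` D)) 2 ->
  ~ vanishes_on b Y ->
  (forall w v, vanishes_on (w * c - b * v) Y ->
     forall y, D y -> w.@[y 0] = 0 -> v.@[y 0] = 0) ->
  exists r, vanishes_on (c - r * b) Y.
Proof.
move=> [[clY irrY] normY] [DY clYD] codimD nz_b nopole.
have [L [rho [rhoP rho_surj]]] := coordinate_ring irrY.
have noethL := noetherian_image rho_surj (@noetherian_mpoly K n).
have normL (x y : L) d (e : 'I_d -> L) : y != 0 ->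
    x ^+ d + \sum_(i < d) e i * x ^+ i * y ^+ (d - i) = 0 ->
    exists r, x = r * y.
  have [p <-] := rho_surj x; have [q <-] := rho_surj y => nz_q.
  have /choice[e' e'E] i := rho_surj (e i).
  move=> eq0; have /rhoP vanY : rho (p ^+ d +
      \sum_(i < d) e' i * p ^+ i * q ^+ (d - i)) = 0.
    rewrite -eq0 rmorphD rmorph_sum rmorphXn; congr (_ + _).
    by apply: eq_bigr => i _; rewrite !rmorphM !rmorphXn e'E.
  have [||r rE] := normY p q d e'.
  - by move/rhoP/eqP; rewrite (negPf nz_q).
  - move=> v Yv qv; have := vanY v Yv.
    rewrite rmorphD rmorph_sum rmorphXn /= => /(congr1 ( *%R (q.@[v 0] ^- d))).
    rewrite mulr0 mulrDr mulr_sumr => E; rewrite -[RHS]E; congr (_ + _).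
      by rewrite expr_div_n mulrC.
    apply: eq_bigr => i _; rewrite !rmorphM !rmorphXn /= expr_div_n.
    have -> : q.@[v 0] ^+ d = q.@[v 0] ^+ i * q.@[v 0] ^+ (d - i).
      by rewrite -exprD subnKC // ltnW.
    rewrite invfM mulrACA.
    by rewrite mulVf ?expf_neq0 // mulr1 [RHS]mulrC -mulrA.
  exists (rho r); apply: (mulfI nz_q); apply/eqP; rewrite -subr_eq0.
  rewrite -!rmorphM -rmorphB; apply/eqP/rhoP => v Yv.
  rewrite rmorphB !rmorphM /=; have [->|qv] := eqVneq q.@[v 0] 0.
    by rewrite !mul0r subrr.
  by rewrite -rE // divfK // subrr.
have nz_rb : rho b != 0 by apply/eqP => /rhoP.
have [[r]|npole] := pselect (exists r, rho c = r * rho b).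
  have [r' <-] := rho_surj r => E; exists r'; apply/rhoP.
  by rewrite rmorphB rmorphM E subrr.
have [P [w [v [Pprime]]]] := pole_divisor noethL normL nz_rb npole.
have [w' <-] := rho_surj w; have [v' <-] := rho_surj v => Pw nPv wcbv height1.
have P'prime := prime_ideal_preimage rho Pprime.
pose V := zeros (rho @^-1` P).
have [clV [V0 irrV]] : affine_variety V := zeros_variety P'prime.
have VY : V `<=` Y.
  move=> y Vy; apply: (zclosed_mem clY) => p /rhoP p0.
  by apply: Vy; rewrite /preimage /= p0; case: Pprime.
have [y [Vy Dy vy]] : exists y, [/\ V y, D y & v'.@[y 0] != 0].
  apply: contrapT => H.
  have [|VD|Vv] := irrV _ _ clYD (zclosed_zeros [set v']).
  - move=> y Vy; have [Dy|nDy] := pselect (D y); last by left; split; [exact: VY|].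
    right=> _ ->; apply: contrapT => /eqP nz; apply: H; exists y.
    by split.
  - have [||C [C0 Cvar Clt]] := codimD V; first by split.
      by move=> y /VD YDy p; apply.
    have [[clC1 irrC1] C1Y] := Cvar 1%N isT.
    have [_ C2Y] := Cvar 2%N isT.
    have [C01 nC10] := Clt 0%N isT; have [_ nC21] := Clt 1%N isT.
    have [|Qprime Qrho] := prime_ideal_image rho_surj _ (vanishing_prime irrC1).
      by move=> p /rhoP pY z /C1Y/pY.
    apply: nC10; rewrite C0 => z C1z p Pp.
    suff /Qrho : (rho @` [set p | vanishes_on p (C 1%N)]) (rho p) by apply.
    (* The ideal of C 1 is nonzero in K[Y], for C 1 misses a point of C 2. *)
    apply: height1 Pp => //.
      move=> _ [q qC1 <-]; apply: (vanishing_zeros P'prime) => u Vu.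
      by apply: qC1; apply: C01; rewrite C0.
    move: nC21 => /existsNP[u /not_implyP[C2u /(zclosed_separate clC1)[q qC1 qu]]].
    exists (rho q); first by exists q.
    by apply/eqP => /rhoP/(_ u (C2Y _ C2u))/eqP; rewrite (negPf qu).
  - by apply: nPv; apply: (vanishing_zeros P'prime) => y /Vv; apply.
move/eqP: vy; case; apply: (nopole w' v' _ y) => //; last exact: Vy.
by apply/rhoP; rewrite rmorphB !rmorphM wcbv subrr.
Qed.

(** * Quotients from separating invariants *)

Lemma dense_nonvanishing (K : fieldType) n (Y D : set 'rV[K]_n) :
  zopen_in Y D -> D !=set0 ->
  exists g, ~ vanishes_on g Y /\ forall y, Y y -> g.@[y 0] != 0 -> D y.
Proof.
move=> [DY clYD] [y0 Dy0]; have [|g gYD gy0] := zclosed_separate (v := y0) clYD.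
  by case.
exists g; split; first by move=> /(_ _ (DY _ Dy0))/eqP; rewrite (negPf gy0).
move=> y Yy gy; apply: contrapT => nDy.
by move/eqP: gy; apply; apply: gYD.
Qed.

(** Separation over D makes f a rational function c/b of mu. This function has
    no pole at a point y = mu(x) of W: if w (c/b) = v, then w(mu) f = v(mu)
    on X, so that v vanishes at y along with w. *)
Theorem factors_through (K : closedFieldType) m s (X : set 'rV[K]_m)
    (Y D W : set 'rV[K]_s) (mu : 'rV[K]_m -> 'rV[K]_s) (f : 'rV[K]_m -> K) :
  [pchar K] =i pred0 -> affine_variety X -> normal_variety Y ->
  morphism id X Y mu -> dominant X Y mu ->
  zopen_in Y D -> D !=set0 ->
  zopen_in Y W -> W `<=` mu @` X -> codim_ge Y (zclosure (Y `\` W)) 2 ->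
  regular id X f ->
  (forall x x', X x -> X x' -> D (mu x) -> mu x = mu x' -> f x = f x') ->
  exists r : {mpoly K[s]}, forall x, X x -> f x = r.@[mu x 0].
Proof.
move=> charK varX normY [muXY mureg] domY Dopen D0 Wopen WmuX codimW [F fF] sep.
have /choice[q qE] := mureg.
pose lq := mktuple q.
have muE p x : X x -> (p \mPo lq).@[x 0] = p.@[mu x 0].
  move=> Xx; rewrite comp_mpoly_meval; apply: meval_eq => i.
  by rewrite tnth_mktuple -qE.
have vanE p : vanishes_on (p \mPo lq) X <-> vanishes_on p Y.
  split=> pX v Vv; last by rewrite muE // pX //; apply: muXY.
  by apply: (domY v Vv) => _ [x Xx <-]; rewrite -muE // pX.
have [g [nz_g gD]] := dense_nonvanishing Dopen D0.
have [||b [c [nz_b bFc]]] := @separated_rational K m s X lq F g charK varX.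
- by move/vanE.
- move=> x x' Xx Xx' gx xx'; rewrite -!fF //; apply: sep => //.
    by apply: gD; [exact: muXY | rewrite -muE].
  by apply/rowP => i; rewrite !qE // -!(tnth_mktuple q) xx'.
have {}bFc x : X x -> b.@[mu x 0] * f x = c.@[mu x 0].
  move=> Xx; have := bFc x Xx; rewrite rmorphB rmorphM /= !muE // -fF //.
  by move/eqP; rewrite subr_eq0 => /eqP.
have cancel_b p : vanishes_on ((b \mPo lq) * p) X -> vanishes_on p X.
  have [_ irrX] := varX; have [_ _ _ _ H] := vanishing_prime irrX.
  by move=> /H[/nz_b|].
have {}nz_b : ~ vanishes_on b Y by move/vanE.
have [|r crb] := regular_in_codim1 (c := c) normY Wopen codimW nz_b.
  move=> w v wv y /WmuX[x Xx <-] w0.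
  suff : vanishes_on ((w \mPo lq) * F - (v \mPo lq)) X.
    move=> /(_ x Xx); rewrite rmorphB rmorphM /= !muE // w0 mul0r sub0r => /eqP.
    by rewrite oppr_eq0 => /eqP.
  apply: cancel_b => z Xz.
  have E : w.@[mu z 0] * c.@[mu z 0] = b.@[mu z 0] * v.@[mu z 0].
    apply/eqP; rewrite -subr_eq0; apply/eqP.
    by have := wv _ (muXY z Xz); rewrite rmorphB !rmorphM.
  rewrite rmorphM rmorphB rmorphM /= !muE // -fF // mulrBr -E -bFc //.
  by rewrite mulrCA subrr.
exists r => x Xx.
suff : vanishes_on (F - (r \mPo lq)) X.
  move=> /(_ x Xx); rewrite rmorphB /= muE // -fF // => /eqP.
  by rewrite subr_eq0 => /eqP.
apply: cancel_b => z Xz.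
have E : c.@[mu z 0] = r.@[mu z 0] * b.@[mu z 0].
  apply/eqP; rewrite -subr_eq0; apply/eqP.
  by have := crb _ (muXY z Xz); rewrite rmorphB rmorphM.
by rewrite rmorphM rmorphB /= !muE // -fF // mulrBr bFc // E mulrC subrr.
Qed.

(** An invariant morphism to an affine Z is given by invariant functions, hence
    by polynomials in mu. They map Y into Z and are determined on Y because the
    equations to be checked hold on the dense image of mu. *)
Lemma quotient_of_spec (K : fieldType) m s (E : 'rV[K]_m -> 'rV[K]_m -> Prop)
    (X : set 'rV[K]_m) (Y : set 'rV[K]_s) (mu : 'rV[K]_m -> 'rV[K]_s) :
  spec_invariants id E X Y mu -> algebraic_quotient E X Y mu.
Proof.
move=> [clY muXY dom inv]; have [mu_in mureg] := muXY; split=> //.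
  move=> x x' Xx Xx' xx'; apply/rowP => i.
  apply: ((inv _ (mureg i)).2 _ _ _ Xx Xx' xx').
  by exists 'X_i => z Xz; rewrite mevalXU.
move=> k Z f [I ->] [fZ freg] finv.
have /choice[p pE] i :
    exists p : {mpoly K[s]}, forall x, X x -> f x 0 i = p.@[mu x 0].
  by apply/inv => // x x' Xx Xx' /finv ->.
pose fhat (y : 'rV[K]_s) : 'rV[K]_k := \row_i (p i).@[y 0].
have fhatE x : X x -> f x = fhat (mu x).
  by move=> Xx; apply/rowP => i; rewrite mxE pE.
exists fhat; split=> //.
  split=> [y Yy g Ig|i]; last by exists (p i) => y _; rewrite mxE.
  have <- : (g \mPo mktuple p).@[y 0] = g.@[fhat y 0].
    by rewrite comp_mpoly_meval; apply: meval_eq => i; rewrite tnth_mktuple mxE.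
  apply: dom Yy => x Xx; rewrite comp_mpoly_meval -(fZ x Xx g Ig).
  by apply: meval_eq => i; rewrite tnth_mktuple pE.
move=> h [_ hreg] fh y Yy; apply/rowP => i; have [r rE] := hreg i.
rewrite rE // mxE; apply/eqP; rewrite -subr_eq0 -rmorphB; apply/eqP.
apply: dom Yy => x Xx; rewrite rmorphB /= -pE // fh //.
by rewrite (rE (mu x)) ?subrr //; apply: mu_in.
Qed.

(** The complement of Y in Y is empty: this is what makes a surjective mu
    a case of the codimension condition, with all of Y as open subset. *)
Lemma codim_ge_empty (K : fieldType) n (Y : set 'rV[K]_n) k :
  codim_ge Y (zclosure (Y `\` Y)) k.
Proof.
rewrite setDv => W [_ [[w Ww] _]] /(_ w Ww)/(_ 1) H.
suff : (1 : {mpoly K[n]}).@[w 0] = 0 by rewrite rmorph1 => /eqP; rewrite oner_eq0.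
by apply: H.
Qed.

(* In the first alternative of h3 the points of YU are values of mu. Without   *)
(* this the claim fails: for G trivial, the projection mu of {xy = 1} to the   *)
(* affine line Y = YU is injective but not a quotient.                         *)
Theorem lemma6p1 (R : realType) (n q m s : nat)
  (G U : set 'M[R[i]]_n)
  (hG : reductive_group G) (hU : unipotent_group U) (hUG : U `<=` G)
  (X : set 'rV[R[i]]_m) (actX : 'M[R[i]]_n -> 'rV[R[i]]_m -> 'rV[R[i]]_m)
  (hX : affine_variety X) (hactX : algebraic_action G X actX)
  (Y : set 'rV[R[i]]_s) (actY : 'M[R[i]]_n -> 'rV[R[i]]_s -> 'rV[R[i]]_s)
  (hY : affine_variety Y) (hactY : algebraic_action G Y actY)
  (* Q = G//U, with its projection pi, left action of G and base point e *)
  (Q : set 'rV[R[i]]_q) (pi : 'M[R[i]]_n -> 'rV[R[i]]_q)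
  (hQ : spec_invariants (@gl_coord _ n) (same_left_coset U) G Q pi)
  (actQ : 'M[R[i]]_n -> 'rV[R[i]]_q -> 'rV[R[i]]_q)
  (hactQ : algebraic_action G Q actQ)
  (hpi : forall g h, G g -> G h -> pi (g *m h) = actQ g (pi h))
  (e : 'rV[R[i]]_q) (he : Q e) (hpie : forall g, G g -> pi g = actQ g e)
  (mu' : 'rV[R[i]]_q * 'rV[R[i]]_m -> 'rV[R[i]]_s)
  (hmu' : morphism (fun p => row_mx p.1 p.2) (Q `*` X) Y mu')
  (hmu'G : forall g z x, G g -> Q z -> X x -> mu' (actQ g z, actX g x) = mu' (z, x))
  (mu : 'rV[R[i]]_m -> 'rV[R[i]]_s)
  (hmu : morphism id X Y mu) (hmudom : dominant X Y mu)
  (hmuU : orbit_invariant (same_orbit U actX) X mu)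
  (hmumu' : forall x, X x -> mu' (e, x) = mu x)
  (h1 : normal_variety Y)
  (YU : set 'rV[R[i]]_s)
  (h2 : separates_orbits_generically (same_orbit U actX) X Y YU mu)
  (h3 : (YU `<=` mu @` X /\ codim_ge Y (zclosure (Y `\` YU)) 2)
        \/ mu @` X = Y) :
  algebraic_quotient (same_orbit U actX) X Y mu
  /\ spec_invariants id (same_orbit U actX) X Y mu.
Proof.
suff spec : spec_invariants id (same_orbit U actX) X Y mu.
  by split=> //; apply: quotient_of_spec.
have [YUopen YU0 sepU] := h2; have [clY _] := hY.
have [W [Wopen WmuX codimW]] : exists W, [/\ zopen_in Y W, W `<=` mu @` X &
    codim_ge Y (zclosure (Y `\` W)) 2].
  case: h3 => [[YUmu codimYU]|muX]; first by exists YU.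
  exists Y; split; [split=> // | by rewrite muX | exact: codim_ge_empty].
  exists [set 1]; rewrite setDv; apply/seteqP; split=> v // /(_ _ erefl).
  by rewrite rmorph1 => /eqP; rewrite oner_eq0.
split=> // [p pX|f freg].
  move=> y /hmudom; apply=> _ [x Xx <-].
  exact: pX.
split=> [finv|[p fp] x x' Xx Xx' xx']; last by rewrite !fp // (hmuU x x').
apply: (factors_through _ hX h1 hmu hmudom YUopen YU0 Wopen WmuX codimW freg).
  exact: Num.Theory.pchar_num.
move=> x x' Xx Xx' YUx xx'; apply: contrapT => fxx'.
apply: (sepU x x') => //; first by rewrite -xx'.
by move=> /(finv _ _ Xx Xx').
Qed.
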